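(* Let $\Omega\subseteq\mathbb{R}^d$ and let $C_i\subseteq\Omega$, $i\in I=\{1,\dots,k\}$. For $n\in\mathbb{N}$ choose $Z_n=2^{-n}\mathbb{Z}^d\cap\Omega$ and $X_{i,n}:=Z_n\cap C_i=\{\mathbf{x}_i^{1,n},\dots,\mathbf{x}_i^{L_{i,n},n}\}$. Assume the sets $C_i$ satisfy an interior cone condition. Then for each $i\in I$ the fill distance $$h_{X_{i,n},C_i}:=\sup_{\mathbf{x}_i\in C_i}\ \min_{\ell=1,\dots,L_{i,n}}\|\mathbf{x}_i-\mathbf{x}_i^{\ell,n}\|_2$$ satisfies $\lim_{n\to\infty}h_{X_{i,n},C_i}=0$.
   Context: Standing assumptions: $\Omega\subseteq\mathbb{R}^d$ is a bounded domain with Lipschitz boundary, $\mathbf{0}\in\Omega^\circ$, the sets $C_i\subseteq\Omega$ are closed, $I$ is finite and $\bigcup_{i\in I}C_i=\Omega$. Interior cone condition: a set $K\subseteq\mathbb{R}^d$ satisfies an interior cone condition if there exist an angle $\alpha\in(0,\pi/2)$ and a radius $r>0$ such that for every $\mathbf{x}\in K$ there is a unit vector $\xi(\mathbf{x})$ such that the cone $C(\mathbf{x},\xi(\mathbf{x}),\alpha,r):=\{\mathbf{x}+\lambda\mathbf{y}:\mathbf{y}\in\mathbb{R}^d,\ \|\mathbf{y}\|_2=1,\ \mathbf{y}^T\xi(\mathbf{x})\ge\cos(\alpha),\ \lambda\in[0,r]\}$ is contained in $K$. *)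

(* Defs.v *)
From HB Require Import structures.
From mathcomp Require Import all_boot all_order all_algebra.
From mathcomp Require Import all_classical all_reals all_analysis.

Set Implicit Arguments.
Unset Strict Implicit.
Unset Printing Implicit Defensive.

Import Order.TTheory GRing.Theory Num.Theory.
Import numFieldNormedType.Exports.

Local Open Scope classical_set_scope.
Local Open Scope ring_scope.

(* Row vectors 'rV[R]_d model R^d. The library norm on 'rV[R]_d is the sup
   norm: it induces the usual topology and bounded sets, but metric notions
   below go through the Euclidean norm [norm2]. *)
Definition dot (R : realType) (d : nat) (u v : 'rV[R]_d) : R :=
  \sum_(j < d) u 0 j * v 0 j.

Definition norm2 (R : realType) (d : nat) (u : 'rV[R]_d) : R :=
  Num.sqrt (dot u u).

(* Near each boundary point, U is the strict epigraph of a Lipschitz function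
   over a hyperplane. The rigid change of coordinates is given by the unit
   "vertical" vector e: the vertical coordinate of x is [dot x e], the horizontal
   ones are those of the orthogonal projection of x on the hyperplane e^perp,
   and only the values of g on e^perp matter. *)
Definition lipschitz_boundary (R : realType) (d : nat)
    (U : set 'rV[R]_d) : Prop :=
  forall p : 'rV[R]_d, (closure U `\` U°) p ->
    exists (rho L : R) (e : 'rV[R]_d) (g : 'rV[R]_d -> R),
      [/\ 0 < rho,
          norm2 e = 1,
          (forall y z : 'rV[R]_d, dot y e = 0 -> dot z e = 0 ->
             `|g y - g z| <= L * norm2 (y - z)) &
          (forall x : 'rV[R]_d, norm2 (x - p) < rho ->
             (U x <-> g (x - dot x e *: e) < dot x e))].

Definition lipschitz_domain (R : realType) (d : nat)
    (U : set 'rV[R]_d) : Prop :=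
  [/\ open U, U !=set0, connected U & lipschitz_boundary U].

(* Omega is closed here, since it will be a finite union of closed sets: it is
   the closure of its interior, and the latter is a domain in the usual (open,
   connected) sense. *)
Definition bounded_closed_lipschitz_domain (R : realType) (d : nat)
    (Omega : set 'rV[R]_d) : Prop :=
  [/\ bounded_set Omega, closure (Omega°) = Omega &
      lipschitz_domain (Omega°)].

Definition cone (R : realType) (d : nat) (x xi : 'rV[R]_d) (alpha r : R) :
    set 'rV[R]_d :=
  [set z | exists (y : 'rV[R]_d) (lambda : R),
     [/\ norm2 y = 1, cos alpha <= dot y xi, 0 <= lambda <= r &
         z = x + lambda *: y]].

Definition interior_cone_condition (R : realType) (d : nat)
    (K : set 'rV[R]_d) : Prop :=
  exists alpha r : R,
    [/\ 0 < alpha < pi / 2, 0 < r &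
        forall x, K x ->
          exists2 xi : 'rV[R]_d, norm2 xi = 1 & cone x xi alpha r `<=` K].

Definition grid (R : realType) (d : nat) (Omega : set 'rV[R]_d) (n : nat) :
    set 'rV[R]_d :=
  [set x | exists z : 'rV[int]_d, x = 2 ^- n *: map_mx intr z] `&` Omega.

(* Valued in [0, +oo]. The infimum is a minimum when X is finite and nonempty,
   and is +oo when X is empty (as may happen for coarse grids). The max with 0
   only matters for empty C, where it makes the supremum 0. *)
Definition fill_distance (R : realType) (d : nat) (X C : set 'rV[R]_d) :
    \bar R :=
  maxe 0%E
    (ereal_sup [set ereal_inf [set (norm2 (x - y))%:E | y in X] | x in C]).

(* Main.v *)
Require Import Defs.
From HB Require Import structures.
From mathcomp Require Import all_boot all_order all_algebra.
From mathcomp Require Import all_classical all_reals all_analysis.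
From mathcomp Require Import lra.
Import Order.TTheory GRing.Theory Num.Theory.
Import numFieldNormedType.Exports.
Local Open Scope classical_set_scope.
Local Open Scope ring_scope.

(** A truncated cone of opening [alpha] contains, at every small distance [t]
    from its apex, a ball whose radius is a fixed fraction
    [c = (1 - cos alpha) / 2] of [t], centred on the axis ([ball_sub_cone]).
    Since the cone condition is uniform over the set [K], any set of points that
    meets every ball of radius [c * t] has a point in [K] within [2 * t] of each
    point of [K], as soon as [2 * t <= r] ([fill_distance_net]).  The lattice of
    mesh [2 ^- n] meets every ball of radius [2 ^- n * sqrt d]
    ([grid_covering_radius]), so that [t] can be taken proportional to [2 ^- n]:
    the fill distance is eventually bounded by a constant times [2 ^- n]. *)

Section EuclideanNorm.
Context {R : realType} {d : nat}.
Implicit Types u v w : 'rV[R]_d.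

Lemma dotC u v : dot u v = dot v u.
Proof. by apply: eq_bigr => j _; rewrite mulrC. Qed.

Lemma dotDl u v w : dot (u + v) w = dot u w + dot v w.
Proof. by rewrite -big_split; apply: eq_bigr => j _; rewrite mxE mulrDl. Qed.

Lemma dotZl a u v : dot (a *: u) v = a * dot u v.
Proof. by rewrite /dot mulr_sumr; apply: eq_bigr => j _; rewrite mxE mulrA. Qed.

Lemma dotDr u v w : dot u (v + w) = dot u v + dot u w.
Proof. by rewrite dotC dotDl !(dotC u). Qed.

Lemma dotZr a u v : dot u (a *: v) = a * dot u v.
Proof. by rewrite dotC dotZl dotC. Qed.

Lemma dot_ge0 u : 0 <= dot u u.
Proof. by apply: sumr_ge0 => j _; rewrite -expr2 sqr_ge0. Qed.

Lemma norm2_ge0 u : 0 <= norm2 u.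
Proof. exact: sqrtr_ge0. Qed.

Lemma sqr_norm2 u : norm2 u ^+ 2 = dot u u.
Proof. by rewrite sqr_sqrtr ?dot_ge0. Qed.

Lemma norm2Z a u : norm2 (a *: u) = `|a| * norm2 u.
Proof.
by rewrite /norm2 dotZl dotZr mulrA -expr2 sqrtrM ?sqr_ge0// sqrtr_sqr.
Qed.

Lemma norm2B u v : norm2 (u - v) = norm2 (v - u).
Proof. by rewrite -opprB -scaleN1r norm2Z normrN1 mul1r. Qed.

(** Cauchy-Schwarz inequality: the part of [w] orthogonal to [u] has a
    nonnegative square. *)
Lemma dot_unit_le w u : norm2 u = 1 -> `|dot w u| <= norm2 w.
Proof.
move=> u1; have uu : dot u u = 1 by rewrite -sqr_norm2 u1 expr1n.
have := dot_ge0 (w + (- dot w u) *: u).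
rewrite dotDl !dotDr !dotZl !dotZr uu (dotC u w) => h.
rewrite -(ler_pXn2r (n := 2)) ?nnegrE ?norm2_ge0 ?normr_ge0 //.
by rewrite real_normK ?num_real // sqr_norm2; lra.
Qed.

Lemma norm2_unitD_le t u w : 0 <= t -> norm2 u = 1 ->
  norm2 (t *: u + w) <= t + norm2 w.
Proof.
move=> t0 u1; have uu : dot u u = 1 by rewrite -sqr_norm2 u1 expr1n.
rewrite -(ler_pXn2r (n := 2)) ?nnegrE ?addr_ge0 ?norm2_ge0 //.
rewrite sqr_norm2 dotDl !dotDr !dotZl !dotZr uu (dotC u w) -(sqr_norm2 w).
have /ler_normlP[_ h] := dot_unit_le w _ u1.
have := ler_wpM2l t0 h.
by lra.
Qed.

End EuclideanNorm.

(** With [c = (1 - cos alpha) / 2], a vector [v] at distance at most [c t] from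
    [t xi] satisfies [<v, xi> >= (1 - c) t] and [|v| <= (1 + c) t], while
    [cos alpha * (1 + c) <= 1 - c] amounts to [0 <= (1 - cos alpha) ^ 2]. *)
Lemma ball_sub_cone (R : realType) (d : nat) (x xi z : 'rV[R]_d) (alpha r t : R) :
  norm2 xi = 1 -> 0 <= cos alpha -> 0 < t -> 2 * t <= r ->
  norm2 (z - (x + t *: xi)) <= (1 - cos alpha) / 2 * t ->
  cone x xi alpha r z /\ norm2 (x - z) <= 2 * t.
Proof.
move=> xi1 k0 t0 tr; set k := cos alpha in k0 *; set w := z - _ => ws.
have xixi : dot xi xi = 1 by rewrite -sqr_norm2 xi1 expr1n.
pose v := t *: xi + w.
have zv : z = x + v by rewrite /v /w addrA addrC subrK.
have vle := norm2_unitD_le _ _ w (ltW t0) xi1.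
have vdot : t - norm2 w <= dot v xi.
  have /ler_normlP[h _] := dot_unit_le w _ xi1.
  by rewrite dotDl dotZl xixi; lra.
have kt : 0 <= k * t by rewrite mulr_ge0 // ltW.
have vxi : 0 < dot v xi by lra.
have v0 : 0 < norm2 v.
  have /ler_normlP[_ h] := dot_unit_le v _ xi1.
  exact: lt_le_trans h.
have v2t : norm2 v <= 2 * t by rewrite (le_trans vle)//; lra.
split; last by rewrite zv norm2B addrC addKr.
exists ((norm2 v)^-1 *: v), (norm2 v); split.
- by rewrite norm2Z gtr0_norm ?invr_gt0 // mulVf // gt_eqF.
- rewrite dotZl mulrC ler_pdivlMr // -/k.
  apply: le_trans vdot.
  apply: (le_trans (ler_wpM2l k0 vle)).
  have : 0 <= (1 - k) ^+ 2 * t by rewrite mulr_ge0 ?sqr_ge0 // ltW.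
  have := ler_wpM2l k0 ws.
  by lra.
- by rewrite norm2_ge0 (le_trans v2t).
- by rewrite scalerA divff ?gt_eqF // scale1r.
Qed.

Lemma fill_distance_ge0 (R : realType) (d : nat) (X C : set 'rV[R]_d) :
  (0 <= fill_distance X C)%E.
Proof. by rewrite /fill_distance le_max lexx. Qed.

Lemma fill_distance_le (R : realType) (d : nat) (X C : set 'rV[R]_d) (e : R) :
  0 <= e -> (forall x, C x -> exists2 y, X y & norm2 (x - y) <= e) ->
  (fill_distance X C <= e%:E)%E.
Proof.
move=> e0 XC; rewrite /fill_distance ge_max lee_fin e0 /=.
apply: ge_ereal_sup => _ [x Cx <-].
have [y Xy xy] := XC x Cx.
apply: (@le_trans _ _ (norm2 (x - y))%:E); last by rewrite lee_fin.
by apply: ereal_inf_lbound; exists y.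
Qed.

Lemma fill_distance_net (R : realType) (d : nat) (G K : set 'rV[R]_d)
    (alpha r t : R) :
  0 <= cos alpha -> 0 < t -> 2 * t <= r ->
  (forall x, K x -> exists2 xi, norm2 xi = 1 & cone x xi alpha r `<=` K) ->
  (forall w, exists2 z, G z & norm2 (z - w) <= (1 - cos alpha) / 2 * t) ->
  (fill_distance (G `&` K) K <= (2 * t)%:E)%E.
Proof.
move=> k0 t0 tr Kcone Gnet; apply: fill_distance_le => [|x Kx].
  by rewrite mulr_ge0 // ltW.
have [xi xi1 xiK] := Kcone x Kx.
have [z Gz zs] := Gnet (x + t *: xi).
have [zcone zt] := ball_sub_cone _ _ _ _ _ _ _ _ xi1 k0 t0 tr zs.
by exists z => //; split => //; exact: xiK.
Qed.

(** Rounding each coordinate down to a multiple of [2 ^- n] moves it by at most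
    [2 ^- n]. *)
Lemma grid_covering_radius (R : realType) (d n : nat) (w : 'rV[R]_d) :
  exists2 z, grid setT n z & norm2 (z - w) <= 2 ^- n * Num.sqrt d%:R.
Proof.
pose m : 'rV[int]_d := \row_j Num.floor (2 ^+ n * w 0 j).
exists (2 ^- n *: map_mx intr m); first by split => //; exists m.
have p0 : 0 < 2 ^+ n :> R by rewrite exprn_gt0.
have q0 : 0 <= 2 ^- n :> R by rewrite invr_ge0 ltW.
have -> : 2 ^- n * Num.sqrt d%:R = Num.sqrt (\sum_(j < d) (2 ^- n) ^+ 2) :> R.
  rewrite sumr_const card_ord -(mulr_natr (_ ^+ 2)) sqrtrM ?sqr_ge0 //.
  by rewrite sqrtr_sqr ger0_norm.
apply: ler_wsqrtr; apply: ler_sum => j _.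
rewrite -expr2 !mxE -real_normK ?num_real // ler_pXn2r ?nnegrE //.
have -> : w 0 j = 2 ^- n * (2 ^+ n * w 0 j) by rewrite mulKf // gt_eqF.
rewrite -mulrBr normrM (ger0_norm q0) mulKf ?gt_eqF //.
rewrite ler_piMr //.
have := floor_le (2 ^+ n * w 0 j); have := floorD1_gt (2 ^+ n * w 0 j).
rewrite intrD => h1 h2; rewrite ler_norml; apply/andP; split; lra.
Qed.

Lemma grid_setI_sub (R : realType) (d n : nat) (Omega K : set 'rV[R]_d) :
  K `<=` Omega -> grid Omega n `&` K = grid setT n `&` K.
Proof.
move=> KO; rewrite /grid setIT; apply/seteqP; split => x.
  by move=> [[? ?] ?].
by move=> [? Kx]; split => //; split => //; exact: KO.
Qed.

Lemma cvg_pow2V (R : realType) (a : R) : 2 ^- n * a @[n --> \oo] --> 0.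
Proof.
rewrite -(mul0r a); apply: cvgMr_tmp.
under eq_fun do rewrite -exprVn.
by apply: cvg_expr; rewrite gtr0_norm ?invr_gt0 // invf_lt1 ?ltr1n.
Qed.

Theorem corollary3p10 (R : realType) (d k : nat)
    (Omega : set 'rV[R]_d) (C : 'I_k -> set 'rV[R]_d)
    (Omega_domain : bounded_closed_lipschitz_domain Omega)
    (Omega_0 : Omega° 0)
    (C_closed : forall i, closed (C i))
    (C_sub : forall i, C i `<=` Omega)
    (C_cover : \bigcup_(i in [set: 'I_k]) C i = Omega)
    (C_cone : forall i, interior_cone_condition (C i))
    (i : 'I_k) :
  fill_distance (grid Omega n `&` C i) (C i) @[n --> \oo] --> 0%E.
Proof.
have [alpha [r [/andP[a0 api] r0 Ccone]]] := C_cone i.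
have k0 : 0 < cos alpha by apply: cos_gt0_pihalf; rewrite api andbT; lra.
have k1 : cos alpha < 1.
  rewrite -cos0 ltr_cos // in_itv /= ?lexx ?pi_ge0 // (ltW a0) /=.
  by have := pi_gt0 R; lra.
set c := (1 - cos alpha) / 2.
have c0 : 0 < c by rewrite /c; lra.
(* [d.+1] instead of [d] keeps [t n] positive in dimension 0. *)
pose t n : R := 2 ^- n * (Num.sqrt d.+1%:R / c).
have t0 n : 0 < t n.
  apply: mulr_gt0; first by rewrite invr_gt0 exprn_gt0.
  by rewrite divr_gt0 ?sqrtr_gt0 ?ltr0n.
have t2_cvg : 2 * t n @[n --> \oo] --> 0.
  by rewrite -(mulr0 2); apply: cvgMl_tmp; exact: cvg_pow2V.
apply: (@squeeze_cvge _ _ _ _ (cst 0%E) _ (fun n => (2 * t n)%:E)).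
- near=> n; rewrite fill_distance_ge0 /= (grid_setI_sub _ _ _ _ _ (C_sub i)).
  apply: (@fill_distance_net _ _ _ _ alpha r) => //; first exact: ltW.
    near: n; have := cvgr_le _ t2_cvg _ r0; exact.
  move=> w; have [z Gz zw] := grid_covering_radius _ _ n w.
  exists z => //; apply: (le_trans zw).
  rewrite -/c /t mulrCA (mulrC c) divfK ?gt_eqF //.
  by rewrite ler_wpM2l ?invr_ge0 ?exprn_ge0 // ler_wsqrtr // ler_nat.
- exact: cvg_cst.
- by apply: cvg_EFin => //; near=> n.
Unshelve. all: by end_near. Qed.
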